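(* There exists a unique pair of double sequences of integers $(c_i(r))$ and $(d_i(r))$, $i,r\ge0$, satisfying the following conditions: (a) $d_i(r)=0$ for all $i\ge2r+1$; (b) $d_{2r}(r)=\frac{1}{r+1}\binom{2r}{r}$ for all $r\ge0$; (c) for each fixed $i$, the function $c_i(r)$ is polynomial in $r$, of degree $\le i$; (d) for each fixed $i$, the function $d_i(r)$ is polynomial in $r$, of degree $\le i$; (e) for all $i,r\ge0$, $\displaystyle c_i(r)=\sum_{j=0}^{2r-i}(-1)^j\binom{2r-j}{i}d_j(r)$. Moreover, these sequences are effectively computable.
   Context: Here ''polynomial in $r$ of degree $\le i$'' means that the function on the integers $r\ge0$ agrees with a polynomial with rational coefficients of degree $\le i$. An empty sum is $0$ (so (e) gives $c_i(r)=0$ for $i>2r$). *)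

(* Defs.v *)
From HB Require Import structures.
From mathcomp Require Import all_boot all_order all_algebra.

Set Implicit Arguments.
Unset Strict Implicit.
Unset Printing Implicit Defensive.

Import Order.TTheory GRing.Theory Num.Theory.

(* Primitive recursion on the first component:
   (0, w) |-> f w  and  (k + 1, w) |-> g (k, value at (k, w), w). *)
Definition primrec (n : nat) (f : n.-tuple nat -> nat)
    (g : n.+2.-tuple nat -> nat) (v : n.+1.-tuple nat) : nat :=
  let w := behead_tuple v in
  nat_rect (fun _ : nat => nat) (f w)
    (fun k y => g (cons_tuple k (cons_tuple y w))) (thead v).

(* Kleene's total (general) recursive functions: the least class of functions
   nat^n -> nat containing the initial functions and closed under composition,
   primitive recursion and minimization of regular functions.  The last
   constructor makes the class invariant under pointwise equality without
   appealing to functional extensionality. *)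
Inductive recursive : forall n : nat, (n.-tuple nat -> nat) -> Prop :=
| rec_zero n : recursive (fun _ : n.-tuple nat => 0)
| rec_succ : recursive (fun v : 1.-tuple nat => (thead v).+1)
| rec_proj n (i : 'I_n) : recursive (fun v : n.-tuple nat => tnth v i)
| rec_comp m n (g : m.-tuple nat -> nat) (h : 'I_m -> n.-tuple nat -> nat) :
    recursive g -> (forall i, recursive (h i)) ->
    recursive (fun v : n.-tuple nat => g [tuple h i v | i < m])
| rec_prim n (f : n.-tuple nat -> nat) (g : n.+2.-tuple nat -> nat) :
    recursive f -> recursive g -> recursive (primrec f g)
| rec_min n (g : n.+1.-tuple nat -> nat)
    (g_regular : forall v : n.-tuple nat,
       exists k, g (cons_tuple k v) == 0) :
    recursive g ->
    recursive (fun v : n.-tuple nat => ex_minn (g_regular v))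
| rec_ext n (f g : n.-tuple nat -> nat) :
    f =1 g -> recursive f -> recursive g.

Local Open Scope ring_scope.

(* An integer is presented by a pair (p, q) of naturals standing for p - q. *)
Definition computable2 (a : nat -> nat -> int) : Prop :=
  exists p q : 2.-tuple nat -> nat,
    [/\ recursive p, recursive q &
        forall i r : nat, a i r = (p [tuple i; r])%:Z - (q [tuple i; r])%:Z].

Definition polynomial_of_degree_le (i : nat) (f : nat -> int) : Prop :=
  exists P : {poly rat},
    (size P <= i.+1)%N /\ forall r : nat, (f r)%:~R = P.[r%:R].

(* The index comes first: [c i r] is c_i(r).  In the last condition, the number
   of terms [(2 * r).+1 - i] is truncated at 0: the sum is empty if i > 2r. *)
Definition cd_conditions (c d : nat -> nat -> int) : Prop :=
  [/\ forall i r : nat, ((2 * r).+1 <= i)%N -> d i r = 0,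
      forall r : nat,
        (d (2 * r)%N r)%:~R = r.+1%:R^-1 * 'C(2 * r, r)%:R :> rat,
      forall i : nat, polynomial_of_degree_le i (c i),
      forall i : nat, polynomial_of_degree_le i (d i) &
      forall i r : nat,
        c i r = \sum_(0 <= j < (2 * r).+1 - i)
                  (-1) ^+ j * 'C(2 * r - j, i)%:R * d j r].

(* Main.v *)
(* Put D_r(X) = \sum_j (-1)^j d_j(r) X^(2r-j).  Condition (e) says that c_i(r) is
   the i-th Taylor coefficient of D_r at 1.  A function is polynomial of degree
   at most i iff it is the sum of its Newton series truncated at order i, so its
   values at 0, ..., i determine all the others and impose nothing on each
   other.  Hence once D_0, ..., D_(r-1) are known, (c) and (d) fix exactly the r
   leading coefficients of D_r and its first r Taylor coefficients at 1, and (b)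
   fixes its constant term: a Hermite interpolation problem with a unique
   integral solution.

   Uniqueness also holds for tables restricted to the indices r <= N and
   i <= 2N.  So d is computed by an unbounded search for the code of a table
   satisfying the finitely many conditions that concern it. *)

Require Import Defs.
From mathcomp Require Import all_boot all_order all_algebra.
From mathcomp Require Import zify ring.
From Stdlib Require Import FunctionalExtensionality.

Set Implicit Arguments.
Unset Strict Implicit.
Unset Printing Implicit Defensive.

Import Order.TTheory GRing.Theory Num.Theory.

(** * Recursive functions of an environment *)

(* Environments are lists of naturals: [nth 0 s i] is the variable of de Bruijn
   index i, and a binder turns the environment [s] into [k :: s]. *)
Definition recursive_seq (f : seq nat -> nat) : Prop :=
  forall n, recursive (fun v : n.-tuple nat => f v).

Lemma rs_ext f g : f =1 g -> recursive_seq f -> recursive_seq g.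
Proof. by move=> fg rf n; apply: rec_ext (rf n) => v; apply: fg. Qed.

Lemma rs_succ f : recursive_seq f -> recursive_seq (fun s => (f s).+1).
Proof.
move=> rf n; apply: rec_ext (rec_comp rec_succ (fun=> rf n)) => v.
by rewrite /thead tnth_mktuple.
Qed.

Lemma rs_const c : recursive_seq (fun=> c).
Proof.
by elim: c => [|c IHc]; [move=> n; exact: rec_zero | exact: rs_succ IHc].
Qed.

Lemma rs_nth i : recursive_seq (fun s => nth 0 s i).
Proof.
move=> n; have [lt_in|le_ni] := ltnP i n.
  apply: rec_ext (rec_proj (Ordinal lt_in)) => v.
  by rewrite (tnth_nth 0).
by apply: rec_ext (@rec_zero n) => v; rewrite nth_default ?size_tuple.
Qed.

(** Composition in Kleene's sense has a fixed number of inner functions for each arity, so the size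
    of the new environment may depend only on the size of the old one; [phi] records this
    dependence. *)
Lemma rs_env g (T : seq nat -> seq nat) (phi : nat -> nat) :
  recursive_seq g -> (forall s, size (T s) = phi (size s)) ->
  (forall i, recursive_seq (fun s => nth 0 (T s) i)) ->
  recursive_seq (fun s => g (T s)).
Proof.
move=> rg szT rT n.
have := rec_comp (rg (phi n)) (fun i : 'I_(phi n) => rT i n).
apply: rec_ext => v; congr (g _).
apply: (@eq_from_nth _ 0) => [|i]; rewrite size_tuple ?szT ?size_tuple // => lt_i.
by rewrite -(tnth_nth 0 _ (Ordinal lt_i)) tnth_mktuple.
Qed.

Lemma rs_behead f : recursive_seq f -> recursive_seq (fun s => f (behead s)).
Proof.
move=> rf; apply: (rs_env (T := behead) (phi := predn) rf) => [s|i].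
  by rewrite size_behead.
by apply: rs_ext (rs_nth i.+1) => s; rewrite nth_behead.
Qed.

Lemma rs_cons f h : recursive_seq f -> recursive_seq h ->
  recursive_seq (fun s => f (h s :: s)).
Proof.
move=> rf rh; apply: (rs_env (T := fun s => h s :: s) (phi := succn) rf).
  by [].
case=> [|i] //=.
exact: rs_nth.
Qed.

Lemma rs_app (F : seq nat -> nat) (fs : seq (seq nat -> nat)) :
  recursive_seq F -> (forall i, recursive_seq (nth (fun=> 0) fs i)) ->
  recursive_seq (fun s => F [seq f s | f <- fs]).
Proof.
move=> rF rfs; apply: (rs_env (T := fun s => [seq f s | f <- fs])
  (phi := fun=> size fs) rF) => [s|i].
  exact: size_map.
apply: rs_ext (rfs i) => s; have [lt_i|le_i] := ltnP i (size fs).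
  by rewrite (nth_map (fun=> 0)).
by rewrite !nth_default ?size_map.
Qed.

Lemma rs_app1 (F : nat -> nat) f :
  recursive_seq (fun s => F (nth 0 s 0)) ->
  recursive_seq f -> recursive_seq (fun s => F (f s)).
Proof.
move=> rF rf; apply: (rs_app (fs := [:: f]) rF) => -[|[|i]] //=;
  exact: rs_const.
Qed.

Lemma rs_app2 (F : nat -> nat -> nat) f g :
  recursive_seq (fun s => F (nth 0 s 0) (nth 0 s 1)) ->
  recursive_seq f -> recursive_seq g -> recursive_seq (fun s => F (f s) (g s)).
Proof.
move=> rF rf rg; apply: (rs_app (fs := [:: f; g]) rF) => -[|[|[|i]]] //=;
  exact: rs_const.
Qed.

Lemma rs_nat_rect f G h :
  recursive_seq f ->
  recursive_seq (fun s => G (nth 0 s 0) (nth 0 s 1) (behead (behead s))) ->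
  recursive_seq h ->
  recursive_seq (fun s => nat_rect (fun=> nat) (f s) (fun k y => G k y s) (h s)).
Proof.
(* [P] takes its counter from the head of the environment, as [primrec] does. The empty environment
   is treated apart: [primrec] has positive arity, and there the counter is the default 0. *)
move=> rf rG rh; pose P s := nat_rect (fun=> nat) (f (behead s))
  (fun k y => G k y (behead s)) (nth 0 s 0).
suff rP : recursive_seq P by apply: rs_ext (rs_cons rP rh).
move=> [|n].
  by apply: rec_ext (rf 0) => v; rewrite tuple0.
apply: rec_ext (rec_prim (rf n) (rG n.+2)) => v.
by rewrite /P /primrec /thead (tnth_nth 0).
Qed.

Lemma rs_min g (g_regular : forall s, exists k, g (k :: s) == 0) :
  recursive_seq g -> recursive_seq (fun s => ex_minn (g_regular s)).
Proof.
move=> rg n; exact: (@rec_min n (fun v => g v) (fun v => g_regular v) (rg n.+1)).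
Qed.

(** * Recursive arithmetic, bounded sums and bounded quantifiers *)

Lemma rs_add f g : recursive_seq f -> recursive_seq g ->
  recursive_seq (fun s => f s + g s).
Proof.
move=> rf rg.
apply: rs_ext (rs_nat_rect (G := fun _ y _ => y.+1) rf _ rg).
  by move=> s; elim: (g s) => [|k /= ->]; rewrite ?addn0 ?addnS.
exact/rs_succ/rs_nth.
Qed.

Lemma rs_mul f g : recursive_seq f -> recursive_seq g ->
  recursive_seq (fun s => f s * g s).
Proof.
move=> rf rg.
apply: rs_ext (rs_nat_rect (G := fun _ y s => y + f s) (rs_const 0) _ rg).
  by move=> s; elim: (g s) => [|k /= ->]; rewrite ?muln0 // mulnSr.
exact: rs_add (rs_nth 1) (rs_behead (rs_behead rf)).
Qed.

Lemma rs_pred f : recursive_seq f -> recursive_seq (fun s => (f s).-1).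
Proof.
move=> rf.
apply: rs_ext (rs_nat_rect (G := fun k _ _ => k) (rs_const 0) _ rf).
  by move=> s; case: (f s).
exact: rs_nth.
Qed.

Lemma rs_sub f g : recursive_seq f -> recursive_seq g ->
  recursive_seq (fun s => f s - g s).
Proof.
move=> rf rg.
apply: rs_ext (rs_nat_rect (G := fun _ y _ => y.-1) rf _ rg).
  by move=> s; elim: (g s) => [|k /= ->]; rewrite ?subn0 // subnS.
exact/rs_pred/rs_nth.
Qed.

Lemma rs_exp f g : recursive_seq f -> recursive_seq g ->
  recursive_seq (fun s => f s ^ g s).
Proof.
move=> rf rg.
apply: rs_ext (rs_nat_rect (G := fun _ y s => f s * y) (rs_const 1) _ rg).
  by move=> s; elim: (g s) => [|k /= ->]; rewrite ?expn0 // expnS.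
exact: rs_mul (rs_behead (rs_behead rf)) (rs_nth 1).
Qed.

Lemma rs_negb (p : seq nat -> bool) :
  recursive_seq p -> recursive_seq (fun s => ~~ p s).
Proof.
by move=> rp; apply: rs_ext (rs_sub (rs_const 1) rp) => s; case: (p s).
Qed.

Lemma rs_and (p q : seq nat -> bool) :
  recursive_seq p -> recursive_seq q -> recursive_seq (fun s => p s && q s).
Proof.
by move=> rp rq; apply: rs_ext (rs_mul rp rq) => s; rewrite mulnb.
Qed.

Lemma rs_implb (p q : seq nat -> bool) :
  recursive_seq p -> recursive_seq q -> recursive_seq (fun s => p s ==> q s).
Proof.
move=> rp rq; apply: rs_ext (rs_negb (rs_and rp (rs_negb rq))) => s.
by rewrite negb_and negbK implybE.
Qed.

Lemma rs_leq f g : recursive_seq f -> recursive_seq g ->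
  recursive_seq (fun s => f s <= g s).
Proof.
move=> rf rg; apply: rs_ext (rs_sub (rs_const 1) (rs_sub rf rg)) => s.
by rewrite /leq; case: (f s - g s).
Qed.

Lemma rs_eqn f g : recursive_seq f -> recursive_seq g ->
  recursive_seq (fun s => f s == g s).
Proof.
move=> rf rg; apply: rs_ext (rs_and (rs_leq rf rg) (rs_leq rg rf)) => s.
by rewrite eqn_leq.
Qed.

Lemma rs_sum F h :
  recursive_seq (fun s => F (nth 0 s 0) (behead s)) -> recursive_seq h ->
  recursive_seq (fun s => \sum_(0 <= k < h s) F k s).
Proof.
move=> rF rh.
apply: rs_ext (rs_nat_rect (G := fun k y s => y + F k s) (rs_const 0) _ rh).
  by move=> s; elim: (h s) => [|k /= ->]; rewrite ?big_nil // big_nat_recr.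
apply: rs_add (rs_nth 1) _.
(* The recursion step sees [k :: y :: s]; the accumulator [y] is removed before [F] is applied. *)
apply: (rs_env (T := fun s => nth 0 s 0 :: behead (behead s))
  (phi := fun n => n.-2.+1) rF) => [s|].
  by rewrite /= !size_behead.
case=> [|i] /=; first exact: rs_nth.
by apply: rs_ext (rs_nth i.+2) => s; rewrite !nth_behead.
Qed.

Lemma rs_all (P : nat -> seq nat -> bool) h :
  recursive_seq (fun s => P (nth 0 s 0) (behead s)) -> recursive_seq h ->
  recursive_seq (fun s => all (fun k => P k s) (iota 0 (h s))).
Proof.
move=> rP rh.
(* A bounded universal statement says that the number of counterexamples is 0. *)
apply: rs_ext (rs_eqn (rs_sum (F := fun k s => ~~ P k s) (rs_negb rP) rh)
  (rs_const 0)) => s.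
congr (nat_of_bool _); elim: (h s) => [|k IHk]; first by rewrite big_nil.
rewrite big_nat_recr // addn_eq0 IHk -addn1 iotaD all_cat /= andbT add0n.
by rewrite eqb0 negbK.
Qed.

Lemma rs_div f g : recursive_seq f -> recursive_seq g ->
  recursive_seq (fun s => f s %/ g s).
Proof.
(* The quotient counts the positive multiples of [d] up to [m]; the guard gives 0 for [d = 0], the
   convention of [%/]. *)
move=> rf rg; pose D m d := \sum_(0 <= k < m) ((0 < d) && (k.+1 * d <= m)).
have rD : recursive_seq (fun s => D (nth 0 s 0) (nth 0 s 1)).
  apply: (rs_sum (F := fun k s =>
    (0 < nth 0 s 1) && (k.+1 * nth 0 s 1 <= nth 0 s 0))) (rs_nth 0).
  apply: rs_and; apply: rs_leq; [exact: rs_const|..].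
  - exact: (rs_behead (rs_nth 1)).
  - apply: rs_mul; [exact/rs_succ/rs_nth | exact: (rs_behead (rs_nth 1))].
  - exact: (rs_behead (rs_nth 0)).
apply: rs_ext (rs_app2 rD rf rg) => s; rewrite /D.
case: (posnP (g s)) => [->|g_gt0]; first by rewrite divn0 big1.
under eq_bigr => k _ do rewrite -leq_divRL //.
have : f s %/ g s <= f s by apply: leq_div.
move: (f s) (f s %/ g s) => m q le_qm.
rewrite (big_cat_nat _ (n := q)) //= [X in _ + X]big_nat_cond [X in _ + X]big1.
  rewrite addn0 (eq_big_nat _ _ (F2 := fun=> 1)) => [|k /andP[_ ->] //].
  by rewrite sum_nat_const_nat subn0 muln1.
by move=> k /andP[/andP[le_qk _] _]; rewrite ltnNge le_qk.
Qed.

Lemma rs_mod f g : recursive_seq f -> recursive_seq g ->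
  recursive_seq (fun s => f s %% g s).
Proof.
move=> rf rg; apply: rs_ext (rs_sub rf (rs_mul (rs_div rf rg) rg)) => s.
by rewrite {1}(divn_eq (f s) (g s)) addKn.
Qed.

Lemma rs_dvdn f g : recursive_seq f -> recursive_seq g ->
  recursive_seq (fun s => f s %| g s).
Proof. by move=> rf rg; exact: rs_eqn (rs_mod rg rf) (rs_const 0). Qed.

Lemma rs_odd f : recursive_seq f -> recursive_seq (fun s => odd (f s)).
Proof.
move=> rf; apply: rs_ext (rs_mod rf (rs_const 2)) => s.
by rewrite modn2.
Qed.

Lemma rs_logn p f : prime p -> recursive_seq f ->
  recursive_seq (fun s => logn p (f s)).
Proof.
move=> p_pr; apply: rs_app1.
apply: rs_ext (rs_sum (F := fun k s => (0 < k) && (p ^ k %| nth 0 s 0))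
  _ (rs_nth 0)) => [s|].
  rewrite logn_count_dvd //; case: (nth 0 s 0) => [|n].
    by rewrite !big_geq.
  by rewrite big_ltn //= add0n; apply: eq_big_nat => k /andP[->].
apply: rs_and; first exact: rs_leq (rs_const 1) (rs_nth 0).
apply: rs_dvdn (rs_behead (rs_nth 0)).
exact: rs_exp (rs_const p) (rs_nth 0).
Qed.

Lemma rs_fact f : recursive_seq f -> recursive_seq (fun s => (f s)`!).
Proof.
move=> rf.
apply: rs_ext (rs_nat_rect (G := fun k y _ => k.+1 * y) (rs_const 1) _ rf).
  by move=> s; elim: (f s) => [|k /= ->] //; rewrite factS.
exact: rs_mul (rs_succ (rs_nth 0)) (rs_nth 1).
Qed.

Lemma rs_ffact f g : recursive_seq f -> recursive_seq g ->
  recursive_seq (fun s => f s ^_ g s).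
Proof.
move=> rf rg.
apply: rs_ext (rs_nat_rect (G := fun k y s => y * (f s - k)) (rs_const 1) _ rg).
  by move=> s; elim: (g s) => [|k /= ->] //; rewrite ffactnSr.
exact: rs_mul (rs_nth 1) (rs_sub (rs_behead (rs_behead rf)) (rs_nth 0)).
Qed.

Lemma rs_bin f g : recursive_seq f -> recursive_seq g ->
  recursive_seq (fun s => 'C(f s, g s)).
Proof.
move=> rf rg; apply: rs_ext (rs_div (rs_ffact rf rg) (rs_fact rg)) => s.
by rewrite bin_ffactd.
Qed.

(** * Newton series *)

Local Open Scope ring_scope.


(** The k-th forward difference of [f] at [n] in closed form; the exponent [k + m] has the parity of
    [k - m]. *)
Definition fdiff (k : nat) (f : nat -> int) (n : nat) : int :=
  \sum_(0 <= m < k.+1) (-1) ^+ (k + m) * 'C(k, m)%:R * f (n + m)%N.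

Definition newton (i : nat) (f : nat -> int) (r : nat) : int :=
  \sum_(0 <= k < i.+1) 'C(r, k)%:R * fdiff k f 0.

Lemma fdiff0 f n : fdiff 0 f n = f n.
Proof. by rewrite /fdiff big_nat1 bin0 !mul1r addn0. Qed.

Lemma fdiffS k f n : fdiff k.+1 f n = fdiff k f n.+1 - fdiff k f n.
Proof.
have sgn m : (-1) ^+ (k.+1 + m.+1) = (-1) ^+ (k + m) :> int.
  by rewrite addSn addnS !exprS mulrA mulN1r opprK mul1r.
rewrite /fdiff big_nat_recl // bin0 mulr1 !addn0.
under eq_bigr => m _ do
  rewrite binS natrD mulrDr mulrDl sgn addnS -addSn.
rewrite big_split /= addrA [LHS]addrC; congr (_ + _).
rewrite [in RHS]big_nat_recl // big_nat_recr //= bin_small // mulr0 mul0r addr0.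
rewrite bin0 mulr1 !addn0 opprD exprS mulN1r mulNr; congr (_ + _).
rewrite -sumrN; apply: eq_bigr => m _.
by rewrite !addnS addSn exprS mulN1r !mulNr opprK.
Qed.

(** Induction on [r] for all [n] at once: expand at [n.+1], replace each difference there by the sum
    of two consecutive differences at [n], and regroup by Pascal's rule. *)
Lemma newton_series f r n :
  f (n + r)%N = \sum_(0 <= k < r.+1) 'C(r, k)%:R * fdiff k f n.
Proof.
elim: r n => [|r IHr] n; first by rewrite big_nat1 bin0 mul1r fdiff0 addn0.
rewrite addnS -addSn IHr.
under eq_bigr => k _ do
  rewrite -[fdiff k f n.+1](subrK (fdiff k f n)) -fdiffS mulrDr addrC.
rewrite big_split /= [RHS]big_nat_recl // bin0 mul1r.
under [in RHS]eq_bigr => k _ do rewrite binS natrD mulrDl.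
rewrite big_split /= addrA; congr (_ + _).
rewrite big_nat_recl // bin0 mul1r; congr (_ + _).
by rewrite [RHS]big_nat_recr //= bin_small // mul0r addr0.
Qed.

Lemma newtonE i f r : (r <= i)%N -> newton i f r = f r.
Proof.
move=> le_ri; rewrite -[r in RHS]add0n newton_series /newton.
rewrite (big_cat_nat (n := r.+1)) //= [X in _ + X]big_nat_cond.
rewrite [X in _ + X]big1 ?addr0 // => k /andP[/andP[lt_rk _] _].
by rewrite bin_small // mul0r.
Qed.

Lemma eq_fdiff k f g n :
  (forall m, (m <= k)%N -> f (n + m)%N = g (n + m)%N) ->
  fdiff k f n = fdiff k g n.
Proof.
move=> fg; apply: eq_big_nat => m /andP[_ le_mk].
by rewrite fg.
Qed.

Lemma eq_newton i f g r :
  (forall m, (m <= i)%N -> f m = g m) -> newton i f r = newton i g r.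
Proof.
move=> fg; apply: eq_big_nat => k /andP[_]; rewrite ltnS => le_ki.
congr (_ * _); apply: eq_fdiff => m le_mk.
by apply: fg; rewrite add0n (leq_trans le_mk).
Qed.

(** The binomial coefficient X choose k as a polynomial in X. *)
Definition bin_poly (k : nat) : {poly rat} :=
  k`!%:R^-1 *: \prod_(m <- iota 0 k) ('X - (m%:R)%:P).

Lemma size_bin_poly k : (size (bin_poly k) <= k.+1)%N.
Proof.
by apply: leq_trans (size_scale_leq _ _) _; rewrite size_prod_XsubC size_iota.
Qed.

Lemma horner_bin_poly k r : (bin_poly k).[r%:R] = 'C(r, k)%:R.
Proof.
have ffactE : (\prod_(m <- iota 0 k) ('X - (m%:R : rat)%:P)).[r%:R]
    = (r ^_ k)%:R.
  elim: k => [|k IHk]; first by rewrite big_nil hornerC.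
  rewrite -addn1 iotaD big_cat big_seq1 hornerM IHk hornerXsubC add0n addn1.
  rewrite ffactnSr natrM; have [le_kr|lt_rk] := leqP k r; first by rewrite natrB.
  by rewrite ffact_small // !mul0r.
rewrite hornerZ ffactE -bin_ffact natrM mulrC mulfK //.
by rewrite pnatr_eq0 -lt0n fact_gt0.
Qed.

Definition newton_poly (i : nat) (f : nat -> int) : {poly rat} :=
  \sum_(0 <= k < i.+1) (fdiff k f 0)%:~R *: bin_poly k.

Lemma size_newton_poly i f : (size (newton_poly i f) <= i.+1)%N.
Proof.
rewrite /newton_poly big_mkord; apply: (leq_trans (size_sum _ _ _)).
apply/bigmax_leqP => k _; apply: leq_trans (size_scale_leq _ _) _.
by apply: leq_trans (size_bin_poly k) _; rewrite ltnS -ltnS.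
Qed.

Lemma horner_newton_poly i f r : (newton_poly i f).[r%:R] = (newton i f r)%:~R.
Proof.
rewrite /newton_poly /newton horner_sum rmorph_sum; apply: eq_bigr => k _.
by rewrite hornerZ horner_bin_poly rmorphM /= rmorph_nat mulrC.
Qed.

(** A polynomial of degree at most [i] is determined by its values at 0, ..., [i], where the Newton
    polynomial agrees with [f]. This turns (c) and (d) into integer identities. *)
Lemma polynomial_of_degree_leP i f :
  polynomial_of_degree_le i f <-> forall r, f r = newton i f r.
Proof.
split=> [[P [szP fP]] r | fN].
  have PN : P - newton_poly i f = 0.
    apply: (@roots_geq_poly_eq0 _ _ [seq m%:R | m <- iota 0 i.+1]).
    - apply/allP => _ /mapP[m + ->]; rewrite mem_iota => /andP[_ lt_mi].
      by rewrite rootE hornerD hornerN -fP horner_newton_poly newtonE // subrr.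
    - rewrite map_inj_uniq ?iota_uniq // => m n /eqP.
      by rewrite eqr_nat => /eqP.
    - rewrite size_map size_iota; apply: leq_trans (size_polyD _ _) _.
      by rewrite geq_max szP size_polyN size_newton_poly.
  apply/eqP; rewrite -(eqr_int rat) fP -horner_newton_poly.
  by move/eqP: PN; rewrite subr_eq0 => /eqP ->.
exists (newton_poly i f); split; first exact: size_newton_poly.
by move=> r; rewrite horner_newton_poly -fN.
Qed.

(** * The polynomials D_r: uniqueness *)

Definition taylor_row (d : nat -> nat -> int) (i r : nat) : int :=
  \sum_(0 <= j < (2 * r).+1 - i) (-1) ^+ j * 'C(2 * r - j, i)%:R * d j r.

(** This is D_r, indexed by the exponent [k = 2r - j]. *)
Definition row_poly (d : nat -> nat -> int) (r : nat) : {poly int} :=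
  \poly_(k < (2 * r).+1) ((-1) ^+ (2 * r - k) * d (2 * r - k)%N r).

Lemma coef_comp_polyXaddC1 (R : comNzRingType) n (p : {poly R}) i :
  (size p <= n)%N ->
  (p \Po ('X + 1%:P))`_i = \sum_(0 <= k < n) 'C(k, i)%:R * p`_k.
Proof.
move=> szp; rewrite coef_comp_poly -(big_mkord xpredT
  (fun k => p`_k * (('X + 1%:P) ^+ k)`_i)) [RHS](big_cat_nat (n := size p)) //=.
rewrite [X in _ = _ + X]big_nat_cond [X in _ = _ + X]big1 ?addr0; last first.
  by move=> k /andP[/andP[le_k _] _]; rewrite nth_default ?mulr0.
apply: eq_bigr => k _; rewrite mulrC; congr (_ * _).
rewrite addrC exprDn coef_sum.
under eq_bigr => j _ do rewrite expr1n mul1r coefMn coefXn.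
have [lt_ik|lt_ki] := ltnP i k.+1.
  rewrite (bigD1 (Ordinal lt_ik)) //= eqxx big1 ?addr0 // => j nij.
  by rewrite eq_sym (negPf (nij : (j : nat) != i)) mul0rn.
rewrite big1 ?bin_small // => j _.
by rewrite gtn_eqF ?mul0rn // (leq_trans (ltn_ord j)).
Qed.

Lemma coef_row_polyXaddC1 d i r :
  (row_poly d r \Po ('X + 1%:P))`_i = taylor_row d i r.
Proof.
rewrite (coef_comp_polyXaddC1 _ (size_poly _ _)) big_nat_rev /= add0n.
have le_i : ((2 * r).+1 - i <= (2 * r).+1)%N by rewrite leq_subr.
rewrite (big_cat_nat (leq0n _) le_i) /=.
rewrite [X in _ + X]big_nat_cond [X in _ + X]big1 ?addr0; last first.
  move=> j /andP[/andP[le_j lt_j] _]; rewrite bin_small ?mul0r //; lia.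
apply: eq_big_nat => j /andP[_ lt_j].
rewrite coef_poly subSS ltnS leq_subr subKn; last lia.
by rewrite mulrCA mulrA.
Qed.

Lemma size_comp_polyXaddC (R : idomainType) (p : {poly R}) (a : R) :
  size (p \Po ('X + a%:P)) = size p.
Proof. by rewrite size_comp_poly2 // size_XaddC. Qed.

(* The first two hypotheses make [p] a multiple of (X - 1)^r. *)
Lemma hermite_unique (R : idomainType) (p : {poly R}) r :
  (size p <= r.+1)%N -> (forall i, (i < r)%N -> (p \Po ('X + 1%:P))`_i = 0) ->
  p`_0 = 0 -> p = 0.
Proof.
move=> szp p1 p0; set q := p \Po _ in p1.
have szq : (size q <= r.+1)%N by rewrite size_comp_polyXaddC.
have pq : p = q \Po ('X - 1%:P) by rewrite comp_polyXaddC_K.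
have qE : q = q`_r *: 'X^r.
  apply/polyP => i; rewrite coefZ coefXn; have [lt_ir|lt_ri|->] := ltngtP i r.
  - by rewrite p1 // mulr0.
  - by rewrite mulr0 nth_default // (leq_trans szq).
  - by rewrite mulr1.
(* Now [p] is [q]_r[times (X - 1)^r, whose value at 0 is]q[_r] up to sign. *)
have q0 : q`_r = 0.
  have : p.[0] == 0 by rewrite horner_coef0 p0.
  rewrite pq horner_comp qE hornerZ hornerXn !hornerE mulf_eq0 expf_eq0.
  by rewrite oppr_eq0 oner_eq0 andbF orbF -qE => /eqP.
by rewrite pq qE q0 scale0r comp_poly0.
Qed.

(* The part of the conditions that only involves rows 0, ..., N. *)
Definition valid_upto (N : nat) (d : nat -> nat -> int) : Prop :=
  forall r, (r < N.+1)%N ->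
  [/\ forall i, (i < (2 * N).+1)%N -> (2 * r < i)%N -> d i r = 0,
      r.+1%:R * d (2 * r)%N r = 'C(2 * r, r)%:R,
      forall i, (i < r)%N -> d i r = newton i (d i) r &
      forall i, (i < r)%N ->
        taylor_row d i r = newton i (taylor_row d i) r].

Lemma eq_taylor_row d d' i r :
  (forall j, (j <= 2 * r)%N -> d j r = d' j r) ->
  taylor_row d i r = taylor_row d' i r.
Proof.
move=> dd'; apply: eq_big_nat => j /andP[_ lt_j].
by rewrite dd' // -ltnS (leq_trans lt_j) // leq_subr.
Qed.

(** Strong induction on the row. Newton series of order below [r] read only earlier rows, so the two
    versions of D_r share their r leading coefficients and their first r Taylor coefficients at 1;
    they also share the constant term, and [hermite_unique] applies to their difference. *)
Lemma valid_upto_unique N d d' : valid_upto N d -> valid_upto N d' ->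
  forall r i, (r <= N)%N -> (i <= 2 * N)%N -> d i r = d' i r.
Proof.
move=> vd vd' r; elim/ltn_ind: r => r IHr i le_rN le_iN.
have [a1 b1 d1 c1] := vd r le_rN; have [a2 b2 d2 c2] := vd' r le_rN.
have [lt_ri|le_ir] := ltnP (2 * r) i; first by rewrite a1 ?a2.
have dlow j : (j < r)%N -> d j r = d' j r.
  move=> lt_jr; rewrite d1 ?d2 //; apply: eq_newton => m le_mj.
  by apply: IHr; lia.
have clow j : (j < r)%N -> taylor_row d j r = taylor_row d' j r.
  move=> lt_jr; rewrite c1 ?c2 //; apply: eq_newton => m le_mj.
  by apply: eq_taylor_row => k le_k; apply: IHr; lia.
have dtop : d (2 * r)%N r = d' (2 * r)%N r.
  have r1_neq0 : r.+1%:R != 0 :> int by rewrite pnatr_eq0.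
  by apply: (mulfI r1_neq0); rewrite b1 b2.
have pE : row_poly d r - row_poly d' r = 0.
  apply: (@hermite_unique _ _ r).
  - apply/leq_sizeP => k lt_rk; rewrite coefB !coef_poly.
    by case: ltnP => [le_k|_]; rewrite ?subrr // dlow ?subrr; lia.
  - move=> j lt_jr.
    by rewrite comp_polyB coefB !coef_row_polyXaddC1 clow ?subrr.
  - by rewrite coefB !coef_poly subn0 dtop subrr.
move/(congr1 (fun p : {poly int} => p`_(2 * r - i))): pE.
rewrite coefB !coef_poly coef0 ltnS leq_subr subKn // -mulrBr => /eqP.
by rewrite mulf_eq0 signr_eq0 subr_eq0 => /eqP.
Qed.

Lemma cd_conditions_valid c d N : cd_conditions c d -> valid_upto N d.
Proof.
case=> ha hb hc hd he r _; split=> [i _ lt_ri||i _|i _].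
- exact: ha.
- apply/eqP; rewrite -(eqr_int rat) rmorphM /= !rmorph_nat hb.
  by rewrite mulVKf // pnatr_eq0.
- by have /polynomial_of_degree_leP := hd i.
- have {}he j m : c j m = taylor_row d j m by exact: he.
  rewrite -he; have /polynomial_of_degree_leP -> := hc i.
  by apply: eq_newton => m _; exact: he.
Qed.

Lemma cd_conditions_unique c d c' d' :
  cd_conditions c d -> cd_conditions c' d' -> c = c' /\ d = d'.
Proof.
move=> cd cd'.
have dd' i r : d i r = d' i r.
  apply: (@valid_upto_unique (i + r)).
  - exact: cd_conditions_valid cd.
  - exact: cd_conditions_valid cd'.
  - lia.
  - lia.
have [_ _ _ _ he] := cd; have [_ _ _ _ he'] := cd'.
split; do 2![apply: functional_extensionality => ?]; last exact: dd'.
by rewrite he he'; apply: eq_bigr => j _; rewrite dd'.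
Qed.

(** * The polynomials D_r: existence *)

(** Since r C(2r, r) = (r+1) C(2r, r+1) and r+1 is coprime to r. *)
Lemma dvdn_catalan r : (r.+1 %| 'C(2 * r, r))%N.
Proof.
rewrite -(Gauss_dvdr _ (coprimeSn r)); apply/dvdnP; exists 'C(2 * r, r.+1).
by rewrite [RHS]mulnC mul_bin_left mul2n -addnn addnK.
Qed.

(** Recovers d from the rows D_r. Without the guard, truncated subtraction would return the constant
    term for every [i > 2r]. *)
Definition top_coef (T : nat -> {poly int}) (i r : nat) : int :=
  if (i <= 2 * r)%N then (-1) ^+ i * (T r)`_(2 * r - i) else 0.

Definition taylor_coef (T : nat -> {poly int}) (i r : nat) : int :=
  (T r \Po ('X + 1%:P))`_i.

(* Hermite interpolation: the next row has prescribed leading coefficients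
   [next_top], prescribed Taylor coefficients at 1 of order less than r, and a
   Catalan number as constant term. *)
Definition next_top (T : nat -> {poly int}) (r : nat) : {poly int} :=
  \poly_(k < (2 * r).+1)
    (if (k <= r)%N then 0
     else (-1) ^+ (2 * r - k) * newton (2 * r - k) (top_coef T (2 * r - k)) r).

(** The correction to the Taylor coefficients left by [next_top], as a polynomial in the variable X
    - 1. *)
Definition next_low (T : nat -> {poly int}) (r : nat) : {poly int} :=
  \poly_(i < r)
    (newton i (taylor_coef T i) r - (next_top T r \Po ('X + 1%:P))`_i).

(** The correction has degree at most r in X - 1, hence keeps the coefficients above X^r. Its term
    of degree r keeps the lower Taylor coefficients and adjusts the constant term: X = 0 means X - 1
    = -1, where the r-th power is the unit (-1)^r, so everything stays integral. *)
Definition next_row (T : nat -> {poly int}) (r : nat) : {poly int} :=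
  next_top T r +
  ((next_low T r
    + ((-1) ^+ r * (('C(2 * r, r) %/ r.+1)%:R - (next_low T r).[-1])) *: 'X^r)
     \Po ('X - 1%:P)).

(** All Newton series involved have order below [r], hence read only earlier rows; this justifies
    the course-of-values recursion in [cd_rows]. *)
Lemma eq_next_row T T' r :
  (forall m, (m < r)%N -> T m = T' m) -> next_row T r = next_row T' r.
Proof.
move=> TT'.
have topE : next_top T r = next_top T' r.
  apply/polyP => k; rewrite !coef_poly; case: ifP => // lt_k.
  case: leqP => // lt_rk; congr (_ * _); apply: eq_newton => m le_m.
  by rewrite /top_coef TT' //; lia.
have lowE : next_low T r = next_low T' r.
  apply/polyP => i; rewrite !coef_poly topE; case: ifP => // lt_ir.
  congr (_ - _); apply: eq_newton => m le_m.
  by rewrite /taylor_coef TT' //; lia.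
by rewrite /next_row lowE topE.
Qed.

Lemma size_comp_polyXsubC (R : idomainType) (p : {poly R}) (a : R) :
  size (p \Po ('X - a%:P)) = size p.
Proof. by rewrite size_comp_poly2 // size_XsubC. Qed.

Lemma comp_polyXsubC_K (R : nzRingType) (p : {poly R}) (z : R) :
  (p \Po ('X - z%:P)) \Po ('X + z%:P) = p.
Proof. by have := comp_polyXaddC_K p (- z); rewrite polyCN opprK. Qed.

Lemma next_row_coef T r k : (r < k)%N -> (next_row T r)`_k = (next_top T r)`_k.
Proof.
move=> lt_rk; rewrite /next_row coefD [X in _ + X]nth_default ?addr0 //.
rewrite size_comp_polyXsubC; apply: leq_trans lt_rk.
apply: leq_trans (size_polyD _ _) _; rewrite geq_max.
rewrite (leq_trans (size_poly _ _)) //=.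
by rewrite (leq_trans (size_scale_leq _ _)) // size_polyXn.
Qed.

Lemma size_next_row T r : (size (next_row T r) <= (2 * r).+1)%N.
Proof.
apply/leq_sizeP => k lt_k; rewrite next_row_coef; last lia.
by rewrite nth_default // (leq_trans (size_poly _ _)).
Qed.

Lemma next_row_coef_comp T r i : (i < r)%N ->
  (next_row T r \Po ('X + 1%:P))`_i = newton i (taylor_coef T i) r.
Proof.
move=> lt_ir; rewrite /next_row comp_polyD coefD comp_polyXsubC_K coefD coefZ.
by rewrite coefXn coef_poly lt_ir ltn_eqF // mulr0 addr0 addrC subrK.
Qed.

Lemma next_row_coef0 T r : (next_row T r)`_0 = ('C(2 * r, r) %/ r.+1)%:R.
Proof.
rewrite -horner_coef0 /next_row hornerD horner_comp !hornerE /=.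
rewrite horner_coef0 coef_poly /= add0r.
by rewrite mulrAC -signr_odd -expr2 sqrr_sign mul1r addrC subrK.
Qed.

Fixpoint cd_rows (n : nat) : seq {poly int} :=
  if n is n'.+1 then rcons (cd_rows n') (next_row (nth 0 (cd_rows n')) n') else [::].

Definition cd_row (r : nat) : {poly int} := (cd_rows r.+1)`_r.

Lemma size_cd_rows n : size (cd_rows n) = n.
Proof. by elim: n => //= n IHn; rewrite size_rcons IHn. Qed.

Lemma nth_cd_rows n r : (r < n)%N -> (cd_rows n)`_r = cd_row r.
Proof.
elim: n => // n IHn; rewrite ltnS leq_eqVlt => /predU1P[-> //|lt_rn].
by rewrite /= nth_rcons size_cd_rows lt_rn IHn.
Qed.

Lemma cd_rowE r : cd_row r = next_row cd_row r.
Proof.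
rewrite /cd_row /= nth_rcons size_cd_rows ltnn eqxx.
by apply: eq_next_row => m /nth_cd_rows ->.
Qed.

Lemma size_cd_row r : (size (cd_row r) <= (2 * r).+1)%N.
Proof. by rewrite cd_rowE size_next_row. Qed.

Lemma row_poly_top_coef r : row_poly (top_coef cd_row) r = cd_row r.
Proof.
apply/polyP => k; rewrite coef_poly; case: ltnP => [lt_k|le_k]; last first.
  by rewrite nth_default // (leq_trans (size_cd_row r)).
rewrite /top_coef leq_subr mulrA subKn // -expr2.
by rewrite -signr_odd sqrr_sign mul1r.
Qed.

Lemma taylor_row_top_coef i r :
  taylor_row (top_coef cd_row) i r = taylor_coef cd_row i r.
Proof. by rewrite -coef_row_polyXaddC1 row_poly_top_coef. Qed.

(** For [r <= i] this is interpolation at a node and constrains nothing; for [i < r] the exponent 2r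
    - i exceeds r, where [next_top] prescribes the value. *)
Lemma top_coef_newton i r :
  top_coef cd_row i r = newton i (top_coef cd_row i) r.
Proof.
have [le_ri|lt_ir] := leqP r i; first by rewrite newtonE.
rewrite {1}/top_coef cd_rowE next_row_coef; last lia.
rewrite ifT; last lia.
rewrite coef_poly ifT; last lia.
rewrite ifF; last lia.
rewrite subKn; last lia.
by rewrite mulrA -expr2 -signr_odd sqrr_sign mul1r.
Qed.

Lemma taylor_coef_newton i r :
  taylor_coef cd_row i r = newton i (taylor_coef cd_row i) r.
Proof.
have [le_ri|lt_ir] := leqP r i; first by rewrite newtonE.
by rewrite {1}/taylor_coef cd_rowE next_row_coef_comp.
Qed.

Lemma cd_conditions_exist : cd_conditions (taylor_coef cd_row) (top_coef cd_row).
Proof.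
split=> [i r lt_ri|r|i|i|i r].
- by rewrite /top_coef leqNgt lt_ri.
- rewrite /top_coef leqnn subnn cd_rowE next_row_coef0 exprM sqrrN !expr1n mul1r.
  rewrite rmorph_nat -{2}(divnK (dvdn_catalan r)) natrM mulrCA mulVf ?mulr1 //.
  by rewrite pnatr_eq0.
- by apply/polynomial_of_degree_leP => r; exact: taylor_coef_newton.
- by apply/polynomial_of_degree_leP => r; exact: top_coef_newton.
- by rewrite -taylor_row_top_coef.
Qed.

(** * Computability *)

Definition recursive_int (f : seq nat -> int) : Prop :=
  exists p q, [/\ recursive_seq p, recursive_seq q &
    forall s, f s = (p s)%:Z - (q s)%:Z].

Lemma ri_ext f g : f =1 g -> recursive_int f -> recursive_int g.
Proof. by move=> fg [p [q [rp rq fE]]]; exists p, q; split=> // s; rewrite -fg. Qed.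

Lemma ri_nat f : recursive_seq f -> recursive_int (fun s => (f s)%:R).
Proof.
move=> rf; exists f, (fun=> 0%N); split=> [//||s]; first exact: rs_const.
by rewrite subr0 natz.
Qed.

Lemma ri_sub f g : recursive_int f -> recursive_int g ->
  recursive_int (fun s => f s - g s).
Proof.
move=> [p [q [rp rq fE]]] [p' [q' [rp' rq' gE]]].
exists (fun s => p s + q' s)%N, (fun s => q s + p' s)%N.
split=> [||s]; try exact: rs_add.
by rewrite fE gE !PoszD; ring.
Qed.

Lemma ri_mul f g : recursive_int f -> recursive_int g ->
  recursive_int (fun s => f s * g s).
Proof.
move=> [p [q [rp rq fE]]] [p' [q' [rp' rq' gE]]].
exists (fun s => p s * p' s + q s * q' s)%N, (fun s => p s * q' s + q s * p' s)%N.
split=> [||s]; try by apply: rs_add; exact: rs_mul.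
by rewrite fE gE !PoszD !PoszM; ring.
Qed.

Lemma ri_sum F h :
  recursive_int (fun s => F (nth 0 s 0) (behead s)) -> recursive_seq h ->
  recursive_int (fun s => \sum_(0 <= k < h s) F k s).
Proof.
move=> [p [q [rp rq FE]]] rh.
(* The premise of [rs_sum] concerns the environment rebuilt from its head and tail, which differs
   from [s] when [s] is empty. *)
have tailE g : recursive_seq g ->
    recursive_seq (fun s => g (nth 0 s 0 :: behead s))%N.
  move=> rg; apply: (rs_env (T := fun s => nth 0%N s 0 :: behead s)
    (phi := fun n => n.-1.+1) rg) => [s|[|i]] /=.
  - by rewrite size_behead.
  - exact: rs_nth.
  - by apply: rs_ext (rs_nth i.+1) => s; rewrite nth_behead.
exists (fun s => \sum_(0 <= k < h s) p (k :: s))%N.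
exists (fun s => \sum_(0 <= k < h s) q (k :: s))%N.
split=> [||s].
- exact: (rs_sum (F := fun k s => p (k :: s)) (tailE _ rp) rh).
- exact: (rs_sum (F := fun k s => q (k :: s)) (tailE _ rq) rh).
rewrite -!natz !natr_sum -sumrB; apply: eq_bigr => k _.
by rewrite !natz -FE.
Qed.

Lemma ri_sign f : recursive_seq f -> recursive_int (fun s => (-1) ^+ f s).
Proof.
move=> rf; exists (fun s => ~~ odd (f s)), (fun s => odd (f s)).
split=> [||s]; [exact/rs_negb/rs_odd | exact: rs_odd |].
by rewrite -signr_odd; case: (odd _).
Qed.

Lemma ri_eq f g : recursive_int f -> recursive_int g ->
  recursive_seq (fun s => f s == g s).
Proof.
move=> [p [q [rp rq fE]]] [p' [q' [rp' rq' gE]]].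
apply: rs_ext (rs_eqn (rs_add rp rq') (rs_add rp' rq)) => s.
by congr nat_of_bool; rewrite fE gE; apply/eqP/eqP => ?; lia.
Qed.

Lemma ri_env g (T : seq nat -> seq nat) (phi : nat -> nat) :
  recursive_int g -> (forall s, size (T s) = phi (size s)) ->
  (forall i, recursive_seq (fun s => nth 0 (T s) i)%N) ->
  recursive_int (fun s => g (T s)).
Proof.
move=> [p [q [rp rq gE]]] szT rT.
exists (fun s => p (T s)), (fun s => q (T s)).
by split=> [||s]; [exact: (rs_env rp szT rT)|exact: (rs_env rq szT rT)|exact: gE].
Qed.

(* [D], defined outside [n] binders, is used under them. *)
Lemma ri_body2 (D : nat -> nat -> seq nat -> int) n a b :
  recursive_int (fun s => D (nth 0 s 0) (nth 0 s 1) (behead (behead s)))%N ->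
  recursive_seq a -> recursive_seq b ->
  recursive_int (fun s => D (a s) (b s) (iter n behead s)).
Proof.
move=> rD ra rb.
apply: (ri_env (T := fun s => [:: a s, b s & iter n behead s])
  (phi := fun m => (m - n).+2) rD) => [s|[|[|i]]] //=.
  by rewrite -drop_behead size_drop.
by apply: rs_ext (rs_nth (n + i)) => s; rewrite -drop_behead nth_drop.
Qed.

Lemma ri_taylor_row (D : nat -> nat -> seq nat -> int) :
  recursive_int (fun s => D (nth 0 s 0) (nth 0 s 1) (behead (behead s)))%N ->
  recursive_int (fun s => taylor_row (fun i r => D i r (behead (behead s)))
                            (nth 0 s 0) (nth 0 s 1))%N.
Proof.
move=> rD; apply: ri_sum.
  apply: ri_mul; last first.
    (* The binders to skip are j, i and r. *)
    apply: (ri_body2 3 rD (rs_nth 0)).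
    exact: (rs_behead (rs_nth 1)).
  apply: ri_mul; first exact/ri_sign/rs_nth.
  apply/ri_nat/rs_bin; last exact: (rs_behead (rs_nth 0)).
  apply: rs_sub (rs_nth 0); apply: rs_mul (rs_const 2) _.
  exact: (rs_behead (rs_nth 1)).
apply: rs_sub (rs_nth 0); apply/rs_succ/rs_mul; first exact: rs_const.
exact: rs_nth.
Qed.

Lemma ri_newton (D : nat -> nat -> seq nat -> int) n a b :
  recursive_int (fun s => D (nth 0 s 0) (nth 0 s 1) (behead (behead s)))%N ->
  recursive_seq a -> recursive_seq b ->
  recursive_int (fun s => newton (a s) (fun m => D (a s) m (iter n behead s)) (b s)).
Proof.
move=> rD ra rb; apply: ri_sum; last exact: rs_succ.
apply: ri_mul.
  by apply/ri_nat/rs_bin; [exact: (rs_behead rb)|exact: rs_nth].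
apply: ri_sum; last exact/rs_succ/rs_nth.
apply: ri_mul; first apply: ri_mul.
- apply/ri_sign/rs_add; [exact: (rs_behead (rs_nth 0)) | exact: rs_nth].
- by apply/ri_nat/rs_bin; [exact: (rs_behead (rs_nth 0)) | exact: rs_nth].
have := ri_body2 n.+2 rD (rs_behead (rs_behead ra)) (rs_nth 0).
by apply: ri_ext => s; rewrite -!iterSr.
Qed.

(** All quantifiers are bounded, which makes validity a recursive test. *)
Definition valid_uptob (N : nat) (d : nat -> nat -> int) : bool :=
  all (fun r =>
    [&& all (fun i => (2 * r < i)%N ==> (d i r == 0)) (iota 0 (2 * N).+1),
        r.+1%:R * d (2 * r)%N r == 'C(2 * r, r)%:R,
        all (fun i => d i r == newton i (d i) r) (iota 0 r) &
        all (fun i => taylor_row d i r == newton i (taylor_row d i) r)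
          (iota 0 r)])
    (iota 0 N.+1).

Lemma all_iotaP (P : pred nat) n :
  reflect (forall i, (i < n)%N -> P i) (all P (iota 0 n)).
Proof.
by apply: (iffP allP) => aP i; have := aP i; rewrite mem_iota add0n.
Qed.

Lemma valid_uptoP N d : reflect (valid_upto N d) (valid_uptob N d).
Proof.
apply: (iffP (all_iotaP _ _)) => vd r lt_rN; have := vd r lt_rN.
  case/and4P=> /all_iotaP a /eqP b /all_iotaP e /all_iotaP t; split=> // i lt_i.
  - by move=> lt_ri; have /implyP/(_ lt_ri)/eqP := a i lt_i.
  - exact/eqP/e.
  - exact/eqP/t.
case=> a b e t; apply/and4P; split; last 2 first.
- by apply/all_iotaP => i lt_i; apply/eqP/e.
- by apply/all_iotaP => i lt_i; apply/eqP/t.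
- by apply/all_iotaP => i lt_i; apply/implyP => lt_ri; apply/eqP/a.
- exact/eqP.
Qed.

(** Needed because a coded table reproduces d only within this range of indices. *)
Lemma eq_valid_upto N d d' :
  (forall r i, (r <= N)%N -> (i <= 2 * N)%N -> d i r = d' i r) ->
  valid_upto N d -> valid_upto N d'.
Proof.
move=> dd' vd r lt_rN; have [a b e t] := vd r lt_rN.
have tt' i m : (m <= N)%N -> taylor_row d i m = taylor_row d' i m.
  by move=> le_mN; apply: eq_taylor_row => j le_j; apply: dd'; lia.
split=> [i lt_i lt_ri||i lt_ir|i lt_ir].
- by rewrite -dd' ?a.
- by rewrite -dd' ?b //; lia.
- rewrite -dd' //; last lia.
  by rewrite e //; apply: eq_newton => m le_m; apply: dd'; lia.
- rewrite -tt' // t //; apply: eq_newton => m le_m; apply: tt'; lia.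
Qed.

Lemma rs_valid_uptob (D : nat -> nat -> seq nat -> int) N :
  recursive_int (fun s => D (nth 0 s 0) (nth 0 s 1) (behead (behead s)))%N ->
  recursive_seq N ->
  recursive_seq (fun s => valid_uptob (N s) (fun i r => D i r s)).
Proof.
move=> rD rN; have rT := ri_taylor_row rD.
apply: rs_all; last exact: rs_succ.
apply: rs_and; last apply: rs_and; last apply: rs_and.
- apply: rs_all; last first.
    by apply/rs_succ/rs_mul; [exact: rs_const | exact: (rs_behead rN)].
  apply: rs_implb; last apply: ri_eq.
  + apply: rs_leq (rs_nth 0); apply/rs_succ/rs_mul; first exact: rs_const.
    exact: (rs_behead (rs_nth 0)).
  + exact: (ri_body2 2 rD (rs_nth 0) (rs_behead (rs_nth 0))).
  + exact: (ri_nat (rs_const 0)).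
- have r2 : recursive_seq (fun s => 2 * nth 0 s 0)%N.
    exact: rs_mul (rs_const 2) (rs_nth 0).
  apply: ri_eq; last exact/ri_nat/rs_bin/rs_nth.
  apply: ri_mul; first exact/ri_nat/rs_succ/rs_nth.
  exact: (ri_body2 1 rD r2 (rs_nth 0)).
- apply: rs_all; last exact: rs_nth.
  apply: ri_eq.
    exact: (ri_body2 2 rD (rs_nth 0) (rs_behead (rs_nth 0))).
  exact: (ri_newton 2 rD (rs_nth 0) (rs_behead (rs_nth 0))).
- apply: rs_all; last exact: rs_nth.
  pose TD i r s := taylor_row (fun i r => D i r s) i r.
  apply: ri_eq.
    exact: (ri_body2 (D := TD) 2 rT (rs_nth 0) (rs_behead (rs_nth 0))).
  exact: (ri_newton (D := TD) 2 rT (rs_nth 0) (rs_behead (rs_nth 0))).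
Qed.

(** * Coding finite tables by natural numbers *)

Lemma digits_exist (B n : nat) (e : nat -> nat) :
  (forall m, (m < n)%N -> (e m < B)%N) ->
  exists a, forall m, (m < n)%N -> (a %/ B ^ m %% B)%N = e m.
Proof.
elim: n e => [|n IHn] e lt_eB; first by exists 0%N.
have [m lt_mn|a aE] := IHn (fun m => e m.+1); first exact: lt_eB.
have lt_e0 := lt_eB 0 isT; have B_gt0 : (0 < B)%N by apply: leq_trans lt_e0.
(* Horner's scheme: [a] codes the digits after the first. *)
exists (a * B + e 0)%N => -[_|m lt_mn].
  by rewrite expn0 divn1 modnMDl modn_small.
by rewrite expnS divnMA divnMDl // (divn_small lt_e0) addn0 aE.
Qed.

(* A table [d] with |d i r| <= K is coded by s = 2^a 3^K, where a has the digits
   d i r + K in base 2K + 1. *)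
Definition table (N s i r : nat) : int :=
  let B := (2 * logn 3 s).+1 in
  (logn 2 s %/ B ^ (i + (2 * N).+1 * r) %% B)%N%:R - (logn 3 s)%:R.

Lemma table_exists N (d : nat -> nat -> int) :
  exists s, forall r i, (r <= N)%N -> (i <= 2 * N)%N -> table N s i r = d i r.
Proof.
(* [W] is the length of a row, so the entry (i, r) is digit number i + W r; [K] bounds all entries,
   and adding it makes the digits nonnegative and at most 2K. *)
pose W := (2 * N).+1; pose n := (W * N.+1)%N.
pose f m := d (m %% W)%N (m %/ W)%N.
pose K := (\max_(m < n) `|f m|)%N.
have leK m : (m < n)%N -> (`|f m| <= K)%N.
  by move=> lt_mn; apply: (leq_bigmax (Ordinal lt_mn)).
have [m lt_mn|a aE] := @digits_exist (2 * K).+1 n (fun m => absz (f m + K%:Z)).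
  by have := leK m lt_mn; lia.
exists (2 ^ a * 3 ^ K)%N => r i le_rN le_iN.
have l2 : logn 2 (2 ^ a * 3 ^ K) = a.
  by rewrite lognM ?expn_gt0 // !lognX !logn_prime //= muln1 muln0 addn0.
have l3 : logn 3 (2 ^ a * 3 ^ K) = K.
  by rewrite lognM ?expn_gt0 // !lognX !logn_prime //= muln1 muln0.
have lt_n : (i + W * r < n)%N by rewrite /n /W; nia.
rewrite /table l2 l3 aE //; have := leK _ lt_n.
have -> : f (i + W * r)%N = d i r.
  by rewrite /f addnC mulnC modnMDl divnMDl // modn_small ?divn_small ?addn0.
lia.
Qed.

Lemma ri_table N c a b : recursive_seq N -> recursive_seq c ->
  recursive_seq a -> recursive_seq b ->
  recursive_int (fun s => table (N s) (c s) (a s) (b s)).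
Proof.
move=> rN rc ra rb; apply: ri_sub; last exact/ri_nat/rs_logn.
have rB : recursive_seq (fun s => (2 * logn 3 (c s)).+1).
  by apply/rs_succ/rs_mul; [exact: rs_const | exact: rs_logn].
apply/ri_nat/rs_mod => //; apply: rs_div; first exact: rs_logn.
apply: rs_exp => //; apply/rs_add/rs_mul => //.
by apply/rs_succ/rs_mul => //; exact: rs_const.
Qed.

(** * Computing d and c by unbounded search *)

Lemma recursive_int_computable2 (f : nat -> nat -> int) :
  recursive_int (fun s => f (nth 0 s 0) (nth 0 s 1))%N -> computable2 f.
Proof.
move=> [p [q [rp rq fE]]]; exists (fun v => p v), (fun v => q v).
by split=> [||i r]; [exact: rp | exact: rq | exact: (fE [:: i; r])].
Qed.

Lemma cd_recursive c d : cd_conditions c d ->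
  recursive_int (fun s => d (nth 0 s 0) (nth 0 s 1))%N.
Proof.
(* With N = i + r, the entry (i, r) lies in the range r <= N, i <= 2N. *)
move=> cd; pose bound s := (nth 0 s 0 + nth 0 s 1)%N.
have r_bound : recursive_seq bound by exact: rs_add (rs_nth 0) (rs_nth 1).
pose invalid t : nat := ~~ valid_uptob (bound (behead t))
  (table (bound (behead t)) (nth 0 t 0)%N).
have r_invalid : recursive_seq invalid.
  apply/rs_negb/(rs_valid_uptob (D := fun i r t =>
    table (bound (behead t)) (nth 0 t 0)%N i r)); last exact: rs_behead.
  apply: ri_table; [|exact: (rs_behead (rs_behead (rs_nth 0)))|
    exact: rs_nth..].
  exact: (rs_behead (rs_behead (rs_behead r_bound))).
(* The search terminates because a code of d itself passes the test. *)
have invalid_regular s : exists k, invalid (k :: s) == 0%N.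
  have [k kE] := table_exists (bound s) d; exists k.
  rewrite eqb0 negbK; apply/valid_uptoP.
  apply: (@eq_valid_upto _ d); last exact: cd_conditions_valid cd.
  by move=> r i le_r le_i; rewrite kE.
have := ri_table r_bound (rs_min invalid_regular r_invalid) (rs_nth 0) (rs_nth 1).
apply: ri_ext => s; case: ex_minnP => k; rewrite eqb0 negbK => /valid_uptoP vk _.
(* Whichever code the search finds first, uniqueness for finite tables forces its entry to be
   [d i r]. *)
apply: (@valid_upto_unique (bound s)) => //; rewrite /bound; try lia.
exact: cd_conditions_valid cd.
Qed.

Lemma cd_computable c d :
  cd_conditions c d -> computable2 c /\ computable2 d.
Proof.
move=> cd; have rd := cd_recursive cd; have [_ _ _ _ he] := cd.
split; apply: recursive_int_computable2 => //.
apply: ri_ext (ri_taylor_row (D := fun i r _ => d i r) rd) => s.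
by rewrite he.
Qed.

Theorem mainTheorem9 :
  (exists! cd : (nat -> nat -> int) * (nat -> nat -> int),
     cd_conditions cd.1 cd.2) /\
  (forall c d : nat -> nat -> int,
     cd_conditions c d -> computable2 c /\ computable2 d).
Proof.
split; last exact: cd_computable.
exists (taylor_coef cd_row, top_coef cd_row); split; first exact: cd_conditions_exist.
by case=> c d /= /(cd_conditions_unique cd_conditions_exist) [-> ->].
Qed.
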